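(* Consider the two-path scheme for a junction with two incoming roads and one outgoing road, as defined in the context, with junction node $J$, steps $\Delta x,\Delta t>0$, maximal density $\rho_{\max}>0$, flux $f$ and Godunov numerical flux $g$. Assume the standing admissibility conventions on the data stated in the context. Let the initial densities around the junction be admissible, namely $$\mu_{J-1}^{0,1}\le \rho_{\max},\qquad \mu_{J-1}^{0,2}\le \rho_{\max},\qquad \mu_{J}^{0,1}+\mu_{J}^{0,2}\le \rho_{\max},\qquad \mu_{J+1}^{0,1}+\mu_{J+1}^{0,2}\le \rho_{\max}.$$ If $$2\,\frac{\Delta t}{\Delta x}\,\sup_{\rho\in(0,\rho_{\max})}|f'(\rho)|\le 1,$$ then $$\mu_{J}^{n,1}+\mu_{J}^{n,2}\le \rho_{\max}\qquad\text{for all } n\in\mathbb{N}.$$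
   Context: **Flux.** Fix $\rho_{\max}>0$. The flux $f:[0,\rho_{\max}]\to\mathbb{R}$ is continuous on $[0,\rho_{\max}]$ and $C^1$ on $(0,\rho_{\max})$, is strictly concave, and satisfies $f(0)=f(\rho_{\max})=0$. The point $\sigma\in(0,\rho_{\max})$ is its unique maximizer: $f(\sigma)=\max_{\omega\in(0,\rho_{\max})} f(\omega)$. **Godunov numerical flux.** For $\rho_-,\rho_+\in[0,\rho_{\max}]$, $$g(\rho_-,\rho_+)=\begin{cases}\min\{f(\rho_-),f(\rho_+)\} & \text{if }\rho_-\le\rho_+,\\ f(\rho_-) & \text{if }\rho_->\rho_+\text{ and }\rho_-<\sigma,\\ f(\sigma) & \text{if }\rho_->\rho_+\text{ and }\rho_-\ge\sigma\ge\rho_+,\\ f(\rho_+) & \text{if }\rho_->\rho_+\text{ and }\rho_+>\sigma.\end{cases}$$ **Network and paths.** The network has one junction with two incoming roads and one outgoing road. There are two paths $P^1,P^2$: path $P^p$ ($p=1,2$) consists of the $p$-th incoming road followed by the common outgoing road. Each path is discretized with space step $\Delta x>0$ by nodes $k=0,1,\dots,K$, where $J$ is the index (the same on both paths) of the first node after the junction, $1\le J$ and $J+1\le K$. Nodes $k<J$ of $P^1$ and nodes $k<J$ of $P^2$ are distinct points (on different incoming roads); nodes $k\ge J$ are common to both paths. Time is discretized with step $\Delta t>0$, time levels indexed by $n\in\mathbb{N}=\{0,1,2,\dots\}$. $\mu_k^{n,p}$ denotes the approximate density, at node $k$ of path $P^p$ and time level $n$, of the vehicles following path $P^p$. **Total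 density.** The total density at node $k$ of path $P^p$ is $$\omega_{k}^{n,(p)}=\begin{cases}\mu_k^{n,p}, & k<J,\\ \mu_k^{n,1}+\mu_k^{n,2}, & k\ge J.\end{cases}$$ **Scheme.** For $p=1,2$, $n\ge 0$ and each interior node $0<k<K$, $$\mu_{k}^{n+1,p}=\mu_{k}^{n,p}-\frac{\Delta t}{\Delta x}\left(\frac{\mu_{k}^{n,p}}{\omega_{k}^{n,(p)}}\,g\big(\omega_{k}^{n,(p)},\omega_{k+1}^{n,(p)}\big)-\frac{\mu_{k-1}^{n,p}}{\omega_{k-1}^{n,(p)}}\,g\big(\omega_{k-1}^{n,(p)},\omega_{k}^{n,(p)}\big)\right),$$ with the convention that a quotient $\mu/\omega$ is $0$ when $\omega=0$. The values at the end nodes $k=0$ and $k=K$ are prescribed at every time level by boundary conditions. **Standing admissibility conventions.** Densities are nonnegative, and they are called admissible at a node if the total density there is at most $\rho_{\max}$. All initial data ($n=0$, every node of both paths) and all prescribed boundary values (nodes $k=0$ and $k=K$, every $n$) are nonnegative and admissible: $\mu_k^{n,p}\ge 0$ and $\omega_k^{n,(p)}\le\rho_{\max}$. *)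

(* Defs.v *)
From HB Require Import structures.
From mathcomp Require Import all_boot all_order all_algebra.
From mathcomp Require Import all_classical all_reals all_analysis.

Set Implicit Arguments.
Unset Strict Implicit.
Unset Printing Implicit Defensive.

Import Order.TTheory GRing.Theory Num.Theory.
Import numFieldNormedType.Exports.

Local Open Scope classical_set_scope.
Local Open Scope ring_scope.

(* The flux is a function on [0, rmax]; it is represented by a total function
   [f : R -> R], and no condition below involves its values outside [0, rmax]
   (the derivative is only taken at interior points). *)
Record is_flux (R : realType) (rmax : R) (f : R -> R) : Prop := IsFlux {
  flux_continuous : {within `[0, rmax], continuous f};
  flux_derivable : {in `]0, rmax[, forall x, derivable f x 1};
  flux_derive_continuous : {in `]0, rmax[, continuous f^`()%classic};
  flux_strictly_concave :
    forall x y t, x \in `[0, rmax] -> y \in `[0, rmax] -> x != y ->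
      t \in `]0, 1[ ->
      t * f x + (1 - t) * f y < f (t * x + (1 - t) * y);
  flux_left : f 0 = 0;
  flux_right : f rmax = 0
}.

Record is_unique_maximizer (R : realType) (rmax : R) (f : R -> R) (sigma : R)
    : Prop := IsUniqueMaximizer {
  maximizer_in : sigma \in `]0, rmax[;
  maximizer_max : {in `]0, rmax[, forall w, f w <= f sigma};
  maximizer_unique : {in `]0, rmax[, forall w, f w = f sigma -> w = sigma}
}.

(* In the branch [rhop < rhom], the last alternative is reached exactly when
   [sigma < rhop]. *)
Definition godunov (R : realType) (f : R -> R) (sigma rhom rhop : R) : R :=
  if rhom <= rhop then Num.min (f rhom) (f rhop)
  else if rhom < sigma then f rhom
  else if rhop <= sigma then f sigma
  else f rhop.

(* The index p = 1, 2 of the paths. *)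
Inductive route := P1 | P2.

(* [m p k] is the density, at node [k] of path [p] and at a fixed time, of the
   vehicles following path [p]. *)
Definition total_density (R : realType) (J : nat) (m : route -> nat -> R)
    (p : route) (k : nat) : R :=
  if (k < J)%N then m p k else m P1 k + m P2 k.

Definition admissible_at (R : realType) (rmax : R) (J : nat)
    (m : route -> nat -> R) (p : route) (k : nat) : Prop :=
  0 <= m p k /\ total_density J m p k <= rmax.

(* [outflux k] is the flux of vehicles of path [p] from node [k] to node
   [k.+1]; since [x / 0 = 0] in a field, the quotient is 0 when the total
   density vanishes. *)
Definition outflux (R : realType) (f : R -> R) (sigma : R) (J : nat)
    (m : route -> nat -> R) (p : route) (k : nat) : R :=
  let w := total_density J m p in
  m p k / w k * godunov f sigma (w k) (w k.+1).

(* [mu n p k]: time level [n], path [p], node [k]; only nodes [k <= K] are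
   meaningful. *)
Definition two_path_scheme (R : realType) (f : R -> R) (sigma dx dt : R)
    (J K : nat) (mu : nat -> route -> nat -> R) : Prop :=
  forall n p k, (0 < k < K)%N ->
    mu n.+1 p k =
      mu n p k - dt / dx * (outflux f sigma J (mu n) p k
                            - outflux f sigma J (mu n) p k.-1).

(* Main.v *)
Require Import Defs.
From HB Require Import structures.
From mathcomp Require Import all_boot all_order all_algebra.
From mathcomp Require Import all_classical all_reals all_analysis.
From mathcomp Require Import lra.

Set Implicit Arguments.
Unset Strict Implicit.

Import Order.TTheory GRing.Theory Num.Theory.
Import numFieldNormedType.Exports.
Local Open Scope classical_set_scope.
Local Open Scope ring_scope.

(** A node can never be overfilled because its inflow dies out linearly as it
fills up. Put [C = (2 * (dt / dx))^-1]. The CFL condition says [`|f'| <= C], so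
the mean value theorem, applied from each of the two zeros [0] and [rmax] of
[f], gives [f x <= C * x] and [f x <= C * (rmax - x)]
([flux_le_left], [flux_le_right]). The Godunov flux inherits both bounds, the
first in its upstream argument and the second in its downstream argument
([godunov_le_upstream], [godunov_le_downstream]).

Consequently, during one time step the vehicles of one path that leave a node
are at most half of those present, and those that enter a node of total density
[w] are at most half of the free space [rmax - w]. The first fact keeps the
densities nonnegative. The second keeps the total density below [rmax], even at
the junction, where two inflows compete for the same free space: this is where
the factor 2 of the CFL condition is consumed. Admissibility is needed at the
neighbouring nodes to run this argument, so the induction on time carries
admissibility of every node of both paths ([scheme_step_admissible]); the
theorem reads it at the node [J]. *)

(** * Bounds on the flux *)

Section FluxBounds.
Context {R : realType} {rmax : R} {f : R -> R}.
Hypothesis flux_f : is_flux rmax f.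

(** An interior point is a convex combination of the two zeros of [f]. *)
Lemma flux_ge0 x : 0 <= x -> x <= rmax -> 0 <= f x.
Proof.
move=> x_ge0 x_le.
have [->|x_neq0] := eqVneq x 0; first by rewrite (flux_left flux_f).
have [->|x_neqr] := eqVneq x rmax; first by rewrite (flux_right flux_f).
have x_gt0 : 0 < x by rewrite lt_neqAle eq_sym x_neq0.
have x_lt : x < rmax by rewrite lt_neqAle x_neqr.
have r_gt0 : 0 < rmax := lt_trans x_gt0 x_lt.
have t01 : x / rmax \in `]0, 1[.
  by rewrite in_itv /= divr_gt0 //= ltr_pdivrMr // mul1r.
have r_in : rmax \in `[0, rmax] by rewrite in_itv /= lexx ltW.
have z_in : 0 \in `[0, rmax] by rewrite in_itv /= lexx ltW.
have := flux_strictly_concave flux_f r_in z_in (lt0r_neq0 r_gt0) t01.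
rewrite (flux_left flux_f) (flux_right flux_f) !mulr0 !addr0.
by rewrite divfK ?gt_eqF// => /ltW.
Qed.

Variable C : R.
Hypothesis derive_le : {in `]0, rmax[, forall x, `|f^`()%classic x| <= C}.

Lemma flux_increment_le x y : 0 <= x -> x <= y -> y <= rmax ->
  `|f y - f x| <= C * (y - x).
Proof.
move=> x_ge0; rewrite le_eqVlt => /predU1P[->|xy] y_le.
  by rewrite !subrr normr0 mulr0.
have inner z : z \in `]x, y[ -> z \in `]0, rmax[.
  rewrite !in_itv /= => /andP[xz zy].
  by rewrite (le_lt_trans x_ge0 xz) (lt_le_trans zy y_le).
have dfE z : z \in `]x, y[ -> is_derive z 1 f (f^`()%classic z).
  move=> /inner z_in; rewrite derive1E.
  exact/derivableP/(flux_derivable flux_f).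
have cf : {within `[x, y], continuous f}.
  apply: continuous_subspaceW (flux_continuous flux_f) => z /=.
  rewrite !in_itv /= => /andP[xz zy].
  by rewrite (le_trans x_ge0 xz) (le_trans zy y_le).
have [z z_in ->] := MVT xy dfE cf.
rewrite normrM [`|y - x|]gtr0_norm ?subr_gt0//.
by rewrite ler_wpM2r ?derive_le ?inner// subr_ge0 ltW.
Qed.

Lemma flux_le_left x : 0 <= x -> x <= rmax -> f x <= C * x.
Proof.
move=> x_ge0 x_le; have := flux_increment_le (lexx 0) x_ge0 x_le.
by rewrite (flux_left flux_f) !subr0; apply: le_trans; exact: ler_norm.
Qed.

Lemma flux_le_right x : 0 <= x -> x <= rmax -> f x <= C * (rmax - x).
Proof.
move=> x_ge0 x_le; have := flux_increment_le x_ge0 x_le (lexx rmax).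
rewrite (flux_right flux_f) sub0r normrN; apply: le_trans; exact: ler_norm.
Qed.

End FluxBounds.

(** The supremum is taken in the extended reals, so that the condition also
says that the derivative is bounded. *)
Lemma cfl_derive_le (R : realType) (rmax lambda : R) (f : R -> R) :
  0 < lambda ->
  ((2 * lambda)%:E
   * ereal_sup [set (`|f^`()%classic x|)%:E | x in `]0%R, rmax[ ] <= 1)%E ->
  {in `]0, rmax[, forall x, `|f^`()%classic x| <= (2 * lambda)^-1}.
Proof.
move=> lambda_gt0 cfl x x_in.
have l2_gt0 : 0 < 2 * lambda by rewrite mulr_gt0.
rewrite -[leRHS]mulr1 ler_pdivlMl // -lee_fin EFinM.
apply: le_trans cfl; apply: lee_wpmul2l; first by rewrite lee_fin ltW.
by apply: ereal_sup_ubound; exists x.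
Qed.

(** * Bounds on the Godunov flux *)

Section GodunovBounds.
Context {R : realType} {rmax : R} {f : R -> R} {sigma : R}.
Hypothesis sigma_in : sigma \in `]0, rmax[.
Variables a b : R.
Hypotheses (a_ge0 : 0 <= a) (a_le : a <= rmax).
Hypotheses (b_ge0 : 0 <= b) (b_le : b <= rmax).

Lemma godunov_ge0 : (forall x, 0 <= x -> x <= rmax -> 0 <= f x) ->
  0 <= godunov f sigma a b.
Proof.
move: sigma_in; rewrite in_itv /= => /andP[/ltW s_ge0 /ltW s_le] f_ge0.
rewrite /godunov; case: (leP a b) => _; first by rewrite le_min !f_ge0.
by case: (ltP a sigma) => _; [exact: f_ge0 | case: (leP b sigma) => _; exact: f_ge0].
Qed.

Variable C : R.
Hypothesis C_ge0 : 0 <= C.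

(** The Godunov flux is bounded by the value of [f] at some point that is at
most [a]. *)
Lemma godunov_le_upstream : (forall x, 0 <= x -> x <= rmax -> f x <= C * x) ->
  godunov f sigma a b <= C * a.
Proof.
move: sigma_in; rewrite in_itv /= => /andP[/ltW s_ge0 /ltW s_le] f_le.
rewrite /godunov; case: (leP a b) => [_|ba]; first by rewrite ge_min f_le.
case: (ltP a sigma) => [_|sa]; first exact: f_le.
case: (leP b sigma) => [_|_]; apply: le_trans (f_le _ _ _) _ => //;
  by rewrite ler_wpM2l // ltW.
Qed.

(** The Godunov flux is bounded by the value of [f] at some point that is at
least [b]. *)
Lemma godunov_le_downstream :
  (forall x, 0 <= x -> x <= rmax -> f x <= C * (rmax - x)) ->
  godunov f sigma a b <= C * (rmax - b).
Proof.
move: sigma_in; rewrite in_itv /= => /andP[/ltW s_ge0 /ltW s_le] f_le.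
rewrite /godunov; case: (leP a b) => [_|ba]; first by rewrite ge_min f_le ?orbT.
case: (ltP a sigma) => [_|_].
  by apply: le_trans (f_le _ _ _) _; rewrite // ler_wpM2l // lerB // ltW.
case: (leP b sigma) => [bs|_]; last exact: f_le.
by apply: le_trans (f_le _ _ _) _; rewrite // ler_wpM2l // lerB.
Qed.

End GodunovBounds.

(** * Propagation of admissibility *)

Section OneStep.
Context {R : realType} {rmax : R} {f : R -> R} {sigma lambda : R} {J K : nat}.
Hypothesis flux_f : is_flux rmax f.
Hypothesis sigma_in : sigma \in `]0, rmax[.
Hypothesis lambda_gt0 : 0 < lambda.
Let C := (2 * lambda)^-1.
Hypothesis derive_le : {in `]0, rmax[, forall x, `|f^`()%classic x| <= C}.
Variable m : route -> nat -> R.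
Hypothesis m_adm : forall p k, (k <= K)%N -> admissible_at rmax J m p k.
Local Notation w := (total_density J m).

Let C_ge0 : 0 <= C.
Proof. by rewrite invr_ge0 mulr_ge0 // ltW. Qed.

Let lambdaC x : lambda * (C * x) = x / 2.
Proof. by rewrite /C invfM mulrA mulrCA mulfV ?gt_eqF// mulr1 mulrC. Qed.

Lemma density_le_total p k : (k <= K)%N -> m p k <= w p k.
Proof.
move=> kK; rewrite /total_density; case: ifP => // _.
by case: p; rewrite ?lerDl ?lerDr; [case: (m_adm P2 kK) | case: (m_adm P1 kK)].
Qed.

Lemma total_ge0 p k : (k <= K)%N -> 0 <= w p k.
Proof.
by move=> kK; apply: le_trans (density_le_total p kK); case: (m_adm p kK).
Qed.

Lemma share_ge0 p k : (k <= K)%N -> 0 <= m p k / w p k.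
Proof. by move=> kK; rewrite divr_ge0 ?total_ge0//; case: (m_adm p kK). Qed.

Lemma share_le1 p k : (k <= K)%N -> m p k / w p k <= 1.
Proof.
move=> kK; have := total_ge0 p kK; rewrite le_eqVlt => /predU1P[<-|w_gt0].
  by rewrite invr0 mulr0.
by rewrite ler_pdivrMr // mul1r density_le_total.
Qed.

Lemma outflux_ge0 p k : (k < K)%N -> 0 <= outflux f sigma J m p k.
Proof.
move=> kK; have kK' := ltnW kK.
rewrite /outflux mulr_ge0 ?share_ge0//.
apply: (godunov_ge0 sigma_in); rewrite ?total_ge0//.
- by case: (m_adm p kK').
- by case: (m_adm p kK).
- exact: (flux_ge0 flux_f).
Qed.

Lemma outflux_le_density p k : (k < K)%N ->
  lambda * outflux f sigma J m p k <= m p k / 2.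
Proof.
move=> kK; have kK' := ltnW kK; have [m_ge0 w_le] := m_adm p kK'.
rewrite -lambdaC ler_pM2l // /outflux.
have gle : godunov f sigma (w p k) (w p k.+1) <= C * w p k.
  apply: (godunov_le_upstream sigma_in) => //; rewrite ?total_ge0//.
  - by case: (m_adm p kK).
  - exact: (flux_le_left flux_f derive_le).
apply: le_trans (ler_wpM2l (share_ge0 p kK') gle) _.
rewrite mulrCA ler_wpM2l //.
have [w0|w_neq0] := eqVneq (w p k) 0; first by rewrite w0 mulr0.
by rewrite divfK.
Qed.

Lemma outflux_le_room p k : (k < K)%N ->
  lambda * outflux f sigma J m p k <= (rmax - w p k.+1) / 2.
Proof.
move=> kK; have kK' := ltnW kK; have [_ wS_le] := m_adm p kK.
rewrite -lambdaC ler_pM2l // /outflux.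
have gle : godunov f sigma (w p k) (w p k.+1) <= C * (rmax - w p k.+1).
  apply: (godunov_le_downstream sigma_in) => //; rewrite ?total_ge0//.
  - by case: (m_adm p kK').
  - exact: (flux_le_right flux_f derive_le).
apply: le_trans (ler_wpM2l (share_ge0 p kK') gle) _.
by rewrite ler_piMl ?share_le1// mulr_ge0 // subr_ge0.
Qed.

(** The inflow at a node is the outflow of the previous node of the same path;
from [J] on, both paths have the same total density, hence the two inflows are
bounded in terms of the same free space. *)
Lemma scheme_step_admissible (m' : route -> nat -> R) k : (0 < k < K)%N ->
  (forall p, m' p k = m p k - lambda * (outflux f sigma J m p k
                                        - outflux f sigma J m p k.-1)) ->
  forall p, admissible_at rmax J m' p k.
Proof.
case: k => [//|k] /= kSK m'E p.
have kK : (k < K)%N := ltnW kSK.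
have in_ge0 q : 0 <= lambda * outflux f sigma J m q k.
  by rewrite mulr_ge0 ?outflux_ge0// ltW.
have out_ge0 q : 0 <= lambda * outflux f sigma J m q k.+1.
  by rewrite mulr_ge0 ?outflux_ge0// ltW.
split.
  have [m_ge0 _] := m_adm p kK.
  have := outflux_le_density p kSK; have := in_ge0 p.
  by rewrite m'E mulrBr; lra.
have m'_le q : m' q k.+1 <= m q k.+1 + (rmax - w q k.+1) / 2.
  have := outflux_le_room q kK; have := out_ge0 q.
  by rewrite m'E mulrBr; lra.
have [_] := m_adm p kK; have := m'_le p; have := m'_le P1; have := m'_le P2.
by rewrite /total_density; case: ifP => _; lra.
Qed.

End OneStep.

Unset Implicit Arguments.
Set Strict Implicit.

Theorem theorem4p1 (R : realType) (rmax : R) (f : R -> R) (sigma dx dt : R)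
  (J K : nat) (mu : nat -> route -> nat -> R)
  (rmax_gt0 : 0 < rmax)
  (flux_f : is_flux rmax f)
  (max_sigma : is_unique_maximizer rmax f sigma)
  (dx_gt0 : 0 < dx) (dt_gt0 : 0 < dt)
  (J_ge1 : (1 <= J)%N) (J_K : (J + 1 <= K)%N)
  (scheme_mu : two_path_scheme f sigma dx dt J K mu)
  (initial_adm : forall p k, (k <= K)%N -> admissible_at rmax J (mu 0%N) p k)
  (boundary_adm : forall n p k, k = 0%N \/ k = K ->
     admissible_at rmax J (mu n) p k)
  (junction_adm : [/\ mu 0%N P1 (J - 1)%N <= rmax,
     mu 0%N P2 (J - 1)%N <= rmax,
     mu 0%N P1 J + mu 0%N P2 J <= rmax &
     mu 0%N P1 (J + 1)%N + mu 0%N P2 (J + 1)%N <= rmax])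
  (cfl : ((2 * (dt / dx))%:E
          * ereal_sup [set (`|f^`()%classic x|)%:E | x in `]0%R, rmax[ ] <= 1)%E) :
  forall n : nat, mu n P1 J + mu n P2 J <= rmax.
Proof.
have lambda_gt0 : 0 < dt / dx by rewrite divr_gt0.
have adm n : forall p k, (k <= K)%N -> admissible_at rmax J (mu n) p k.
  elim: n => [//|n IHn] p k kK.
  have [->|k_neq0] := eqVneq k 0%N; first by apply: boundary_adm; left.
  have [->|k_neqK] := eqVneq k K; first by apply: boundary_adm; right.
  have k_in : (0 < k < K)%N by rewrite lt0n k_neq0 ltn_neqAle k_neqK.
  apply: (scheme_step_admissible flux_f (maximizer_in max_sigma) lambda_gt0
    (cfl_derive_le lambda_gt0 cfl) IHn k_in) => q.
  exact: scheme_mu.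
move=> n; have JK : (J <= K)%N by apply: leq_trans J_K; rewrite leq_addr.
by have [_] := adm n P1 J JK; rewrite /total_density ltnn.
Qed.
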